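(* Let $R$ be a unital left Noetherian ring and $\Gamma$ be a sofic group. Then the group ring $R\Gamma$ is stably direct finite.
   Context: A unital ring $S$ is directly finite if for any $a,b\in S$ with $ab=1$ one has $ba=1$. It is stably direct finite if the matrix ring $M_n(S)$ is directly finite for every $n\in\mathbb{N}$. A discrete group $\Gamma$ is sofic if for every finite $F\subseteq\Gamma$ and every $\delta>0$ there is a map $\sigma:\Gamma\to\mathrm{Sym}(d)$, for some $d\in\mathbb{N}$ (with $\mathrm{Sym}(d)$ the permutation group of $[d]=\{1,\dots,d\}$), such that $|\{v\in[d]:\sigma_s\sigma_t(v)=\sigma_{st}(v)\}|/d>1-\delta$ for all $s,t\in F$ and $|\{v\in[d]:\sigma_s(v)\ne\sigma_t(v)\}|/d>1-\delta$ for all distinct $s,t\in F$. *)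

(* Defs.v *)
From HB Require Import structures.
From mathcomp Require Import all_boot all_order all_fingroup all_algebra.
From mathcomp Require Import finmap monalg.
From mathcomp Require Import reals.

Set Implicit Arguments.
Unset Strict Implicit.
Unset Printing Implicit Defensive.

Import Order.TTheory GRing.Theory Num.Theory.
Local Open Scope fset_scope.
Local Open Scope ring_scope.

(* [pzRingType] is used for "unital ring": it has a unit, need not be
   commutative, and includes the zero ring. *)

Definition directly_finite (S : pzRingType) : Prop :=
  forall a b : S, a * b = 1 -> b * a = 1.

Definition stably_directly_finite (S : pzRingType) : Prop :=
  forall n : nat, directly_finite 'M[S]_n.

Record left_ideal (R : pzRingType) (I : R -> Prop) : Prop := LeftIdeal {
  left_ideal0 : I 0;
  left_idealD : forall x y, I x -> I y -> I (x + y);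
  left_idealM : forall a x, I x -> I (a * x)
}.

Definition left_noetherian (R : pzRingType) : Prop :=
  forall I : nat -> R -> Prop,
    (forall n, left_ideal (I n)) ->
    (forall n x, I n x -> I n.+1 x) ->
    exists N, forall n, (N <= n)%N -> forall x, I n x <-> I N x.

(* [K] is the field of real numbers.  Permutations act on the left in the
   definition of soficity, so the composite sigma_s sigma_t is applied
   explicitly; the product of ['S_d] composes in the opposite order. *)
Definition sofic (K : realType) (Gamma : groupType) : Prop :=
  forall (F : {fset Gamma}) (delta : K), 0 < delta ->
  exists (d : nat) (sigma : Gamma -> 'S_d),
    [/\ (0 < d)%N,
        forall s t : Gamma, s \in F -> t \in F ->
          #|[set v | sigma s (sigma t v) == sigma (s * t)%g v]|%:R / d%:R
            > 1 - delta
      & forall s t : Gamma, s \in F -> t \in F -> s != t ->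
          #|[set v | sigma s v != sigma t v]|%:R / d%:R > 1 - delta].

(* The ring structure that [monalg] puts on [{malg R[K]}] requires [K] to be a
   [monomType], whose only invertible element is the unit.  Only its additive
   group of finitely supported functions applies to a group; the convolution
   product is defined here. *)
Definition group_ring (R : pzRingType) (Gamma : groupType) : Type :=
  {malg R[Gamma]}.

HB.instance Definition _ (R : pzRingType) (Gamma : groupType) :=
  GRing.Zmodule.copy (group_ring R Gamma) {malg R[Gamma]}.

Section GroupRing.
Context (R : pzRingType) (Gamma : groupType).
Implicit Types (a b c : {malg R[Gamma]}) (g h : Gamma).

Definition gr_one : {malg R[Gamma]} := << 1 *g 1%g >>.

Definition gr_mul a b : {malg R[Gamma]} :=
  \sum_(g <- msupp a) \sum_(h <- msupp b) << a@_g * b@_h *g (g * h)%g >>.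

Lemma gr_mulEw (d1 d2 : {fset Gamma}) a b :
  msupp a `<=` d1 -> msupp b `<=` d2 ->
  gr_mul a b = \sum_(g <- d1) \sum_(h <- d2) << a@_g * b@_h *g (g * h)%g >>.
Proof.
move=> le_d1 le_d2; rewrite /gr_mul (big_fset_incl _ le_d1) /=.
  apply/eq_bigr=> g _; apply/big_fset_incl => // h _ /mcoeff_outdom ->.
  by rewrite mulr0 monalgU0.
move=> g _ /mcoeff_outdom ag0.
by rewrite big1 // => h _; rewrite ag0 mul0r monalgU0.
Qed.

Lemma gr_mul0r : left_zero 0 gr_mul.
Proof. by move=> a; rewrite /gr_mul msupp0 big_seq_fset0. Qed.

Lemma gr_mulr0 : right_zero 0 gr_mul.
Proof. by move=> a; rewrite /gr_mul big1 // => g _; rewrite msupp0 big_seq_fset0. Qed.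

Lemma gr_mulUl (x : R) g b :
  gr_mul << x *g g >> b = \sum_(h <- msupp b) << x * b@_h *g (g * h)%g >>.
Proof.
rewrite (gr_mulEw msuppU_le (fsubset_refl _)) big_seq_fset1.
by apply/eq_bigr => h _; rewrite mcoeffUU.
Qed.

Lemma gr_mulUr (x : R) h a :
  gr_mul a << x *g h >> = \sum_(g <- msupp a) << a@_g * x *g (g * h)%g >>.
Proof.
rewrite (gr_mulEw (fsubset_refl _) msuppU_le).
by apply/eq_bigr => g _; rewrite big_seq_fset1 mcoeffUU.
Qed.

Lemma gr_mulUU (x y : R) g h :
  gr_mul << x *g g >> << y *g h >> = << x * y *g (g * h)%g >>.
Proof. by rewrite (gr_mulEw msuppU_le msuppU_le) !big_seq_fset1 !mcoeffUU. Qed.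

Lemma gr_mulDl : left_distributive gr_mul +%R.
Proof.
move=> a b c.
rewrite (gr_mulEw (msuppD_le _ _) (fsubset_refl _)).
rewrite (gr_mulEw (fsubsetUl (msupp a) (msupp b)) (fsubset_refl (msupp c))).
rewrite (gr_mulEw (fsubsetUr (msupp a) (msupp b)) (fsubset_refl (msupp c))).
rewrite -big_split /=; apply/eq_bigr=> g _.
rewrite -big_split /=; apply/eq_bigr=> h _.
by rewrite mcoeffD mulrDl monalgUD.
Qed.

Lemma gr_mulDr : right_distributive gr_mul +%R.
Proof.
move=> c a b.
rewrite (gr_mulEw (fsubset_refl _) (msuppD_le _ _)).
rewrite (gr_mulEw (fsubset_refl (msupp c)) (fsubsetUl (msupp a) (msupp b))).
rewrite (gr_mulEw (fsubset_refl (msupp c)) (fsubsetUr (msupp a) (msupp b))).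
rewrite -big_split /=; apply/eq_bigr=> g _.
rewrite -big_split /=; apply/eq_bigr=> h _.
by rewrite mcoeffD mulrDr monalgUD.
Qed.

Lemma gr_mul1r : left_id gr_one gr_mul.
Proof.
move=> a; rewrite gr_mulUl [RHS]monalgE.
by apply/eq_bigr=> g _; rewrite mul1r mul1g.
Qed.

Lemma gr_mulr1 : right_id gr_one gr_mul.
Proof.
move=> a; rewrite gr_mulUr [RHS]monalgE.
by apply/eq_bigr=> g _; rewrite mulr1 mulg1.
Qed.

Lemma gr_mul_suml I (r : seq I) (F : I -> {malg R[Gamma]}) b :
  gr_mul (\sum_(i <- r) F i) b = \sum_(i <- r) gr_mul (F i) b.
Proof. exact: (big_morph (gr_mul^~ b) (fun _ _ => gr_mulDl _ _ _) (gr_mul0r _)). Qed.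

Lemma gr_mul_sumr I (r : seq I) (F : I -> {malg R[Gamma]}) a :
  gr_mul a (\sum_(i <- r) F i) = \sum_(i <- r) gr_mul a (F i).
Proof. exact: (big_morph (gr_mul a) (fun _ _ => gr_mulDr _ _ _) (gr_mulr0 _)). Qed.

Lemma gr_mulA : associative gr_mul.
Proof.
move=> a b c; rewrite [a]monalgE !gr_mul_suml; apply/eq_bigr=> g _.
rewrite [b]monalgE gr_mul_suml !gr_mul_sumr gr_mul_suml; apply/eq_bigr=> h _.
rewrite [c]monalgE !gr_mul_sumr; apply/eq_bigr=> k _.
by rewrite !gr_mulUU mulrA mulgA.
Qed.

HB.instance Definition _ := GRing.Zmodule_isPzRing.Build (group_ring R Gamma)
  gr_mulA gr_mul1r gr_mulr1 gr_mulDl gr_mulDr.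

End GroupRing.

(* Main.v *)
Require Import Defs.
From mathcomp Require Import all_boot all_order all_fingroup all_algebra.
From mathcomp Require Import finmap monalg boolp reals.
From mathcomp Require Import zify.

(** Suppose that [a * b = 1] in the ring of [n * n] matrices over the group
    ring, and that [e := 1 - b * a] is not zero.  Then [a * e = 0] and
    [e * b = 0], so that the [b ^+ j * e * a ^+ i] behave as matrix units and
    [e * a ^+ i * b ^+ j * e] is [e] or [0] according to whether [i = j]
    ([matrix_units]).  Hence the left ideals generated by [e], [e * a],
    [e * a ^+ 2], ... are nonzero copies of one another and their sum is
    direct: the free module of rank [n] over the group ring contains
    arbitrarily many independent copies of one nonzero submodule.  Soficity
    brings this configuration down to a free [R]-module of finite rank, where
    it contradicts the finiteness of the uniform (Goldie) dimension of [R].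

    A left Noetherian ring may have no finite length or rank that is positive
    on a given submodule, but its uniform dimension is always finite, and it
    is monotone and additive on direct sums.  A finite family [U] is
    said to detect essential submodules if every submodule that meets all the
    lines [R u] nontrivially meets every nonzero line.  A left Noetherian ring
    has such a family ([noetherian_detects]); if it has [r] elements, then the
    module of [d * n] matrices has one with [d * n * r] elements
    ([matrix_detects]).  A Steinitz exchange shows that no independent family
    of nonzero vectors is larger ([independent_card_le]).  So independent
    families of nonzero [d * n] matrices have at most [d * n * r] members.

    Let [rho] be an approximate right action of the group on [d] points, given
    by soficity.  Every point [v] defines an [R]-linear map [spread v] from
    rows over the group ring to [d * n] matrices over [R], which moves the
    coefficient at [g] to the row [rho g v].  Right multiplication by a matrix
    [x] corresponds to an endomorphism [act x] of the [d * n] matrices, and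
    [act x (spread v y) = spread v (y *m x)] holds exactly as soon as [rho] is
    multiplicative at [v] on the finitely many group elements that occur
    ([act_spread]).  Choose a nonzero row [y] of [e], and a set [W] of points
    where [rho] is good, whose translates by the support [s] of [y] are
    disjoint; one can achieve [d <= 2 * size s ^ 2 * #|W|]
    ([disjoint_translates]).  The vectors [spread v (y *m a ^+ i)], for [v] in
    [W] and [i < k], are nonzero, and they are independent: [act (b ^+ j * e)]
    kills those with [i <> j] and sends the others to the vectors
    [spread v y], which have disjoint supports.  Therefore
    [k * #|W| <= d * n * r <= 2 * size s ^ 2 * n * r * #|W|], which fails as
    soon as [k] exceeds [2 * size s ^ 2 * n * r].  The support [s] does not
    depend on [k], so such a [k] may be fixed before [rho] is chosen. *)

Set Implicit Arguments.
Unset Strict Implicit.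
Unset Printing Implicit Defensive.

Import Order.TTheory GRing.Theory Num.Theory.
Local Open Scope ring_scope.

(** * Uniform dimension *)

Section UniformDimension.
Variables (R : pzRingType) (V : lmodType R).
Implicit Types (X Y : V -> Prop) (x y z : V) (U : seq V).

Record submodule X : Prop := Submodule {
  submodule0 : X 0;
  submoduleD : forall x y, X x -> X y -> X (x + y);
  submoduleZ : forall a x, X x -> X (a *: x)
}.

Definition meets_line X y := exists a : R, a *: y != 0 /\ X (a *: y).

(** In a module of finite uniform dimension, the generators of a maximal direct
    sum of uniform cyclic submodules are such a [U], for the whole module; the
    relative version, for a part [Y], allows [U] to be built step by step.
    The size of [U] then bounds the uniform dimension. *)
Definition detects_essential U Y := forall X, submodule X ->
  (forall u, u \in U -> u != 0 -> meets_line X u) ->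
  forall y, Y y -> y != 0 -> meets_line X y.

(** The sum of the cyclic submodules [R (w i)] is direct.  This is weaker than
    linear independence: the [w i] may have torsion. *)
Definition independent (I : finType) (w : I -> V) :=
  forall c : I -> R, \sum_i c i *: w i = 0 -> forall i, c i *: w i = 0.

Lemma meets_lineZ X y (a : R) : meets_line X (a *: y) -> meets_line X y.
Proof. by case=> b []; rewrite scalerA; exists (b * a). Qed.

(** Additivity of the uniform dimension.  Given [y1 + y2], one first multiplies
    by a scalar that brings [y1] into [X] without killing it, and then by a
    second one that does the same to [y2]; the second multiple of [y1] stays
    in [X].  If the first scalar kills [y2], it is already enough. *)
Lemma detects_essential_add U1 U2 Y1 Y2 Y :
  submodule Y1 -> submodule Y2 ->
  (forall y, Y1 y -> Y2 y -> y = 0) ->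
  (forall y, Y y -> exists y1 y2, [/\ Y1 y1, Y2 y2 & y = y1 + y2]) ->
  detects_essential U1 Y1 -> detects_essential U2 Y2 ->
  detects_essential (U1 ++ U2) Y.
Proof.
move=> sY1 sY2 Y12 YD d1 d2 X sX XU y /YD[y1 [y2 [Yy1 Yy2 ->]]] nz.
have d1X : forall y, Y1 y -> y != 0 -> meets_line X y.
  by apply: d1 => // u uU; apply: XU; rewrite mem_cat uU.
have d2X : forall y, Y2 y -> y != 0 -> meets_line X y.
  by apply: d2 => // u uU; apply: XU; rewrite mem_cat uU orbT.
have Y12N z1 z2 : Y1 z1 -> Y2 z2 -> z1 + z2 = 0 -> z1 = 0.
  move=> Yz1 Yz2 /addr0_eq z12; apply: Y12 => //.
  have -> : z1 = (-1) *: z2 by rewrite -z12 scaleN1r opprK.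
  exact: submoduleZ.
case: (eqVneq y1 0) => [y10|y1nz].
  by rewrite y10 add0r; apply: d2X => //; move: nz; rewrite y10 add0r.
have [a [ay1 Xay1]] := d1X _ Yy1 y1nz.
case: (eqVneq (a *: y2) 0) => [ay2|ay2].
  by exists a; rewrite scalerDr ay2 addr0.
have [b [bay2 Xbay2]] := d2X _ (submoduleZ sY2 a Yy2) ay2.
apply: (@meets_lineZ _ _ a); exists b; rewrite scalerDr scalerDr; split.
  apply: contra_neq bay2 => s0.
  have b0 : b *: (a *: y1) = 0.
    by apply: Y12N s0; do 2?apply: submoduleZ => //.
  by move: s0; rewrite b0 add0r.
by apply: submoduleD => //; apply: submoduleZ.
Qed.

(** If no [u] could replace [w i0], then the span of the other vectors would
    meet every line [R u], hence by detection also the line [R (w i0)], against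
    independence. *)
Lemma exchange U (I : finType) (w : I -> V) (i0 : I) :
  detects_essential U (fun=> True) ->
  independent w -> w i0 != 0 ->
  exists u, [/\ u \in U, u != 0 &
    independent (fun i => if i == i0 then u else w i)].
Proof.
move=> dU indw w0.
pose X y := exists c : I -> R, y = \sum_(i | i != i0) c i *: w i.
have sX : submodule X.
  split.
  - by exists (fun=> 0); rewrite big1 // => i _; rewrite scale0r.
  - move=> x y [c ->] [c' ->]; exists (fun i => c i + c' i).
    by rewrite -big_split; apply: eq_bigr => i _; rewrite scalerDl.
  - move=> a x [c ->]; exists (fun i => a * c i).
    by rewrite scaler_sumr; apply: eq_bigr => i _; rewrite scalerA.
have indX c : \sum_(i | i != i0) c i *: w i = 0 ->
    forall i, i != i0 -> c i *: w i = 0.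
  move=> s0 i ii0.
  have := indw (fun i => if i == i0 then 0 else c i).
  rewrite (bigD1 i0) //= eqxx scale0r add0r.
  under eq_bigr => j /negPf -> do [].
  by move=> /(_ s0 i); rewrite (negPf ii0).
have [u [uU unz uX]] : exists u, [/\ u \in U, u != 0 & ~ meets_line X u].
  apply: contrapT => nex.
  have [a [/eqP aw [c awE]]] : meets_line X (w i0).
    apply: (dU X sX) => // u uU unz; apply: contrapT => nu.
    by apply: nex; exists u.
  apply: aw.
  have := indw (fun i => if i == i0 then - a else c i) _ i0.
  rewrite eqxx scaleNr => indwN; apply/eqP; rewrite -oppr_eq0; apply/eqP.
  apply: indwN; rewrite (bigD1 i0) //= eqxx scaleNr awE.
  by under [X in _ + X]eq_bigr => j /negPf -> do []; rewrite addNr.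
exists u; split=> // c; rewrite (bigD1 i0) //= eqxx.
under [X in _ + X = _]eq_bigr => j /negPf -> do [].
move=> s0.
have cu : c i0 *: u = 0.
  apply/eqP/negP => /negP cu; apply: uX; exists (c i0); split=> //.
  exists (fun i => - c i); under eq_bigr do rewrite scaleNr.
  by rewrite sumrN; apply/eqP; rewrite -subr_eq0 opprK s0.
move=> i; case: eqVneq => [-> //|ii0]; apply: indX => //.
by move: s0; rewrite cu add0r.
Qed.

Lemma independent_card_le U (I : finType) (w : I -> V) :
  detects_essential U (fun=> True) ->
  independent w -> (forall i, w i != 0) -> (#|I| <= size U)%N.
Proof.
(* Exchange the vectors outside [U] one by one; a family that lies in [U] is
   injective by independence, and is then no larger than [U]. *)
move=> dU.
have [m] := ubnP #|[pred i | w i \notin U]|.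
elim: m w => // m IHm w ltm indw wnz.
case: (pickP [pred i | w i \notin U]) => [i0 /= i0U|wU].
  have [u [uU unz indu]] := exchange dU indw (wnz i0).
  apply: IHm indu _ => [|i]; last by case: ifP.
  rewrite -ltnS (leq_trans _ ltm) // ltnS (cardD1 i0 [pred i | w i \notin U]).
  rewrite !inE i0U add1n ltnS; apply/subset_leq_card/subsetP => i.
  by rewrite !inE; case: eqVneq => [_|//]; rewrite uU.
have injw : injective w.
  move=> i j wij; apply/eqP/negP => /negP ij; move/eqP: (wnz i); apply.
  have := indw (fun k => (k == i)%:R - (k == j)%:R) _ i.
  rewrite eqxx (negPf ij) subr0 scale1r; apply.
  under eq_bigr do rewrite scalerBl.
  rewrite sumrB (bigD1 i) //= eqxx scale1r big1 => [|k /negPf ->].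
    rewrite (bigD1 j) //= eqxx scale1r big1 => [|k /negPf ->].
      by rewrite !addr0 wij subrr.
    exact: scale0r.
  exact: scale0r.
rewrite cardE -(size_map w); apply: uniq_leq_size.
  by rewrite map_inj_uniq // enum_uniq.
by move=> _ /mapP[i _ ->]; have := wU i; rewrite /= => /negbFE.
Qed.

End UniformDimension.

Lemma detects_essential_free_line (R : pzRingType) (V : lmodType R) (v : V)
    (U : seq R^o) : (forall x : R, x *: v = 0 -> x = 0) ->
  detects_essential U (fun=> True) ->
  detects_essential [seq u *: v | u <- (U : seq R)]
    (fun y => exists x : R, y = x *: v).
Proof.
move=> free_v dU X sX XU _ [x ->] nz.
have v0 (z : R) : (z *: v == 0) = (z == 0).
  by apply/eqP/eqP => [/free_v|->]; rewrite ?scale0r.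
have sfX : submodule (fun x : R^o => X ((x : R) *: v)).
  split=> [|y z Xy Xz|a y Xy].
  - by rewrite scale0r; apply: submodule0.
  - by rewrite scalerDl; apply: submoduleD.
  - by rewrite -scalerA; apply: submoduleZ.
case: (dU _ sfX _ (x : R^o) I) => [u uU unz||a [anz Xa]].
- case: (XU _ (map_f (fun z : R => z *: v) uU)); first by rewrite v0.
  by move=> a; rewrite scalerA v0; exists a.
- by rewrite -v0.
by exists a; rewrite scalerA v0.
Qed.

(** * Uniform dimension of left Noetherian rings *)

Section Noetherian.
Variable R : pzRingType.
Implicit Types (I J : R -> Prop).

Lemma left_ideal_submodule I : left_ideal I <-> submodule (I : R^o -> Prop).
Proof. by split; case; split. Qed.

Lemma left_ideal_add_principal I (u : R) : left_ideal I ->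
  left_ideal (fun x => exists i c, I i /\ x = i + c * u).
Proof.
move=> lI; split.
- by exists 0, 0; rewrite mul0r addr0; split=> //; case: lI.
- move=> _ _ [i [c [Ii ->]]] [j [d [Ij ->]]]; exists (i + j), (c + d).
  by rewrite mulrDl addrACA; split=> //; apply: left_idealD.
- move=> b _ [i [c [Ii ->]]]; exists (b * i), (b * c).
  by rewrite mulrDr !mulrA; split=> //; apply: left_idealM.
Qed.

(** The maximal condition, from the ascending chain condition by dependent
    choice. *)
Lemma left_noetherian_max (P : (R -> Prop) -> Prop) I0 :
  left_noetherian R -> left_ideal I0 -> P I0 ->
  exists I, [/\ left_ideal I, P I &
    forall J, left_ideal J -> P J -> (forall x, I x -> J x) ->
      forall x, J x -> I x].
Proof.
move=> noeth lI0 PI0; apply: contrapT => nmax.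
pose T := {I | left_ideal I /\ P I}.
have nextT (I : T) : exists J : T,
    (forall x, sval I x -> sval J x) /\ exists x, sval J x /\ ~ sval I x.
  apply: contrapT => nJ; apply: nmax; exists (sval I).
  case: (svalP I) => lI PI; split=> // J lJ PJ IJ x Jx.
  apply: contrapT => nIx; apply: nJ.
  by exists (exist _ J (conj lJ PJ)); split=> //; exists x.
have [f fP] := choice nextT.
pose F n := iter n f (exist _ I0 (conj lI0 PI0) : T).
have [||N /(_ N.+1 (leqnSn N)) FN] := noeth (fun n => sval (F n)).
- by move=> n; case: (svalP (F n)).
- by move=> n; case: (fP (F n)).
have [_ [x [Fx nFx]]] := fP (F N).
by apply: nFx; apply/(FN x).
Qed.

(** The left ideal [R u] is a uniform module: its nonzero submodules intersect
    pairwise.  The case [u = 0] is not excluded. *)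
Definition uniform_elt (u : R) := forall a b : R,
  a * u != 0 -> b * u != 0 ->
  exists c d, c * (a * u) = d * (b * u) /\ c * (a * u) != 0.

(** Take a left ideal [I] that is maximal among those that are disjoint from
    some nonzero line [R (a y)] inside [R y].  That line is uniform: if [p] and
    [q] in it generate disjoint lines, then [I + R p] is still disjoint from
    [R q], so that [p] lies in [I] by maximality and vanishes. *)
Lemma exists_uniform (y : R) : left_noetherian R -> y != 0 ->
  exists a, a * y != 0 /\ uniform_elt (a * y).
Proof.
move=> noeth ynz.
pose P I := exists a,
  a * y != 0 /\ forall b, I (b * (a * y)) -> b * (a * y) = 0.
have l0 : left_ideal (eq^~ 0 : R -> Prop).
  by split=> [|x z -> ->|a x ->]; rewrite ?addr0 ?mulr0.
have [|I [lI [a [anz Ia]] maxI]] := @left_noetherian_max P _ noeth l0.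
  by exists 1; rewrite mul1r.
exists a; split=> // p q pnz qnz; apply: contrapT => npq.
pose J x := exists i c, I i /\ x = i + c * (p * (a * y)).
have lJ : left_ideal J by apply: left_ideal_add_principal.
have IJ x : I x -> J x by exists x, 0; rewrite mul0r addr0.
move/eqP: pnz; apply; apply: (Ia); apply: (maxI J lJ _ IJ).
  exists (q * a); rewrite -mulrA; split=> // b [i [c [Ii bE]]].
  apply/eqP/negP => /negP bnz; apply: npq; exists c, b.
  suff i0 : i = 0 by rewrite bE i0 add0r in bnz *.
  have iE : i = (b * q - c * p) * (a * y).
    by rewrite mulrBl -!mulrA bE addrK.
  by rewrite iE; apply: Ia; rewrite -iE.
by exists 0, 1; rewrite add0r mul1r; split=> //; case: lI.
Qed.

(** Take a left ideal [I] that is maximal among those whose nonzero lines are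
    detected by a finite family.  It is essential, and therefore its family
    detects all lines: if [I] missed a line [R y], then adding to [I] a uniform
    line inside [R y] would give a larger detected left ideal. *)
Lemma noetherian_detects : left_noetherian R ->
  exists U : seq R^o, detects_essential U (fun=> True).
Proof.
move=> noeth.
pose P I := exists U : seq R^o, detects_essential U I.
have l0 : left_ideal (eq^~ 0 : R -> Prop).
  by split=> [|x z -> ->|a x ->]; rewrite ?addr0 ?mulr0.
have [|I [lI [U dU] maxI]] := @left_noetherian_max P _ noeth l0.
  by exists [::] => X _ _ y ->; rewrite eqxx.
exists U => X sX XU y _ ynz.
suff [a [anz Ia]] : meets_line (I : R^o -> Prop) y.
  exact: meets_lineZ (dU X sX XU _ Ia anz).
apply: contrapT => nIy.
have [a [anz ua]] := exists_uniform noeth ynz.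
set u := a * y in anz ua.
have Iu c : I (c * u) -> c * u = 0.
  move=> Icu; apply/eqP/negP => /negP cunz; apply: nIy; exists (c * a).
  by rewrite /GRing.scale /= -mulrA.
pose Y (x : R) := exists c, x = c * u.
have sY : submodule (Y : R^o -> Prop).
  split=> [|_ _ [c ->] [d ->]|b _ [c ->]].
  - by exists 0; rewrite mul0r.
  - by exists (c + d); rewrite mulrDl.
  - by exists (b * c); rewrite -mulrA.
have dY : detects_essential [:: u : R^o] Y.
  move=> Z sZ Zu x [c ->] cunz.
  have [b [bunz Zbu]] := Zu u (mem_head _ _) anz.
  have [c' [b' [E nz]]] := ua _ _ cunz bunz.
  exists c'; rewrite /GRing.scale /=; split=> //.
  by rewrite E; apply: (submoduleZ sZ).
pose J x := exists i c, I i /\ x = i + c * u.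
have lJ : left_ideal J by apply: left_ideal_add_principal.
have PJ : P J.
  exists (U ++ [:: u : R^o]).
  apply: (detects_essential_add (proj1 (left_ideal_submodule I) lI) sY) => //.
    by move=> x Ix [c xE]; rewrite xE; apply: Iu; rewrite -xE.
  by move=> x [i [c [Ii ->]]]; exists i, (c * u); split=> //; exists c.
move/eqP: anz; apply; rewrite -[u]mul1r; apply: Iu.
apply: (maxI J lJ PJ) => [x Ix|].
  by exists x, 0; rewrite mul0r addr0.
by exists 0, 1; rewrite add0r; split=> //; case: lI.
Qed.

Lemma matrix_detects (U : seq R^o) d n :
  detects_essential U (fun=> True) ->
  detects_essential
    [seq u *: delta_mx p.1 p.2 | p <- enum {: 'I_d * 'I_n}, u <- (U : seq R)]
    (fun _ : 'M[R]_(d, n) => True).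
Proof.
move=> dU.
pose line p (M : 'M[R]_(d, n)) := exists x : R, M = x *: delta_mx p.1 p.2.
have dline p :
    detects_essential [seq u *: delta_mx p.1 p.2 | u <- (U : seq R)] (line p).
  apply: detects_essential_free_line => // x /matrixP/(_ p.1 p.2).
  by rewrite !mxE !eqxx mulr1.
(* Add the coordinate lines one by one. *)
pose supported (s : seq ('I_d * 'I_n)) (M : 'M[R]_(d, n)) :=
  forall i j, (i, j) \notin s -> M i j = 0.
suff dsupp s : uniq s -> detects_essential
    [seq u *: delta_mx p.1 p.2 | p <- s, u <- (U : seq R)] (supported s).
  move=> X sX XU M _; apply: (dsupp _ (enum_uniq _) X sX XU) => i j.
  by rewrite mem_enum.
elim: s => [_|p s IHs /= /andP[ps us]].
  move=> X _ _ M M0 /eqP[]; apply/matrixP => i j; rewrite mxE.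
  exact: M0.
apply: (@detects_essential_add _ _ _ _ (line p) (supported s)) => //;
  last exact: IHs.
- split=> [|_ _ [x ->] [y ->]|a _ [x ->]].
  + by exists 0; rewrite scale0r.
  + by exists (x + y); rewrite scalerDl.
  + by exists (a * x); rewrite scalerA.
- split=> [i j _|M N M0 N0 i j ij|a M M0 i j ij]; rewrite mxE //.
  + by rewrite M0 // N0 // addr0.
  + by rewrite M0 // mulr0.
- move=> _ [x ->] sM; case: p ps sM => p1 p2 ps sM.
  have := sM p1 p2 ps; rewrite !mxE !eqxx /= mulr1 => ->.
  by rewrite scale0r.
- move=> M sM; exists (M p.1 p.2 *: delta_mx p.1 p.2).
  exists (M - M p.1 p.2 *: delta_mx p.1 p.2); split.
  + by exists (M p.1 p.2).
  + move=> i j ij; rewrite !mxE; case: eqVneq => [ip|ip] /=.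
      case: eqVneq => [jp|jp] /=; first by rewrite mulr1 ip jp subrr.
      rewrite mulr0 subr0; apply: sM; rewrite inE negb_or ij andbT.
      by apply: contraNneq jp => <-.
    rewrite mulr0 subr0; apply: sM; rewrite inE negb_or ij andbT.
    by apply: contraNneq ip => <-.
  + by rewrite addrC subrK.
Qed.

Lemma independent_matrices_bounded : left_noetherian R ->
  exists r : nat, forall d n (I : finType) (w : I -> 'M[R]_(d, n)),
    independent w -> (forall i, w i != 0) -> (#|I| <= d * n * r)%N.
Proof.
case/noetherian_detects => U dU; exists (size U) => d n I w indw wnz.
have := independent_card_le (@matrix_detects U d n dU) indw wnz.
by rewrite size_allpairs -cardE card_prod !card_ord.
Qed.

End Noetherian.

(** * Good points of sofic approximations *)

Lemma card_bigcup_le (I : Type) (T : finType) (s : seq I) (B : I -> {set T}) :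
  (#|\bigcup_(i <- s) B i| <= \sum_(i <- s) #|B i|)%N.
Proof.
elim/big_rec2: _ => [|i m A _ leAm]; first by rewrite cards0.
by rewrite (leq_trans (leq_card_setU _ _)) ?leq_add2l.
Qed.

Lemma mem_bigcup_seq (I : eqType) (T : finType) (s : seq I)
    (B : I -> {set T}) i x :
  i \in s -> x \in B i -> x \in \bigcup_(j <- s) B j.
Proof. by move=> si Bx; rewrite (big_rem i si) inE Bx. Qed.

Lemma card_compl_small (K : realType) d M (A : {set 'I_d}) :
  (0 < d)%N -> (0 < M)%N ->
  1 - (M%:R)^-1 < #|A|%:R / d%:R :> K -> (M * #|~: A| <= d)%N.
Proof.
move=> d0 M0.
have dK : 0 < d%:R :> K by rewrite ltr0n.
have MK : 0 < M%:R :> K by rewrite ltr0n.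
rewrite ltr_pdivlMr // mulrBl mul1r ltrBlDr -ltrBlDl.
have -> : d%:R - #|A|%:R = #|~: A|%:R :> K.
  by apply/eqP; rewrite subr_eq -natrD addnC cardsC card_ord.
rewrite ltr_pdivlMl // -natrM ltr_nat; exact: ltnW.
Qed.

(** The permutations [sigma g] of the sofic approximation multiply like a left
    action, so [rho g := sigma g^-1] is an approximate right action.  This is
    what right multiplication by group ring elements requires.  The points
    where one of the finitely many conditions on [F] fails are at most half of
    all points. *)
Lemma sofic_good_points (K : realType) (Gamma : groupType) (F : seq Gamma) :
  sofic K Gamma ->
  exists (d : nat) (rho : Gamma -> 'S_d) (A : {set 'I_d}),
    [/\ (0 < d)%N, (d <= #|A| * 2)%N,
        forall g h v, g \in F -> h \in F -> v \in A ->
          rho h (rho g v) = rho (g * h)%g v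
      & forall g h v, g \in F -> h \in F -> v \in A ->
          rho g v = rho h v -> g = h].
Proof.
(* There are [N ^ 2] pairs and two conditions per pair, each failing on at most
   [d / M] points, and [2 * N ^ 2 / M <= 1 / 2]. *)
move=> sof; set N := size F; pose M := (4 * N ^ 2).+1.
pose Fi : {fset Gamma} := [fset g in [seq g^-1%g | g <- F]]%fset.
have FiP g : g \in F -> g^-1%g \in Fi by move=> gF; rewrite inE /= map_f.
have [|d [sigma [d0 multF injF]]] := sof Fi (M%:R^-1).
  by rewrite invr_gt0 ltr0n.
pose rho g := sigma g^-1%g.
pose S (p : Gamma * Gamma) :=
  [set v | rho p.2 (rho p.1 v) == rho (p.1 * p.2)%g v].
pose D (p : Gamma * Gamma) :=
  [set v | (p.1 == p.2) || (rho p.1 v != rho p.2 v)].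
pose FF := [seq (g, h) | g <- F, h <- F].
pose bad := \bigcup_(p <- FF) (~: S p :|: ~: D p).
have goodP g h v : g \in F -> h \in F -> v \in ~: bad ->
    v \in S (g, h) /\ v \in D (g, h).
  move=> gF hF; rewrite inE => vbad; apply/andP; apply: contraNT vbad.
  rewrite negb_and -!in_setC -in_setU => vb.
  by apply: (@mem_bigcup_seq _ _ _ _ (g, h)); rewrite ?allpairs_f.
exists d, rho, (~: bad); split=> //.
- suff : (#|bad| * 2 <= d)%N by have := cardsC bad; rewrite card_ord; lia.
  have small p : p \in FF -> (M * #|~: S p :|: ~: D p| <= 2 * d)%N.
    case/allpairsP => -[g h] /= [gF hF ->].
    have sS : (M * #|~: S (g, h)| <= d)%N.
      apply: (@card_compl_small K) => //.
      by have := multF _ _ (FiP _ hF) (FiP _ gF); rewrite -invMg.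
    have sD : (M * #|~: D (g, h)| <= d)%N.
      have [<-|gh] := eqVneq g h.
        rewrite (_ : D _ = setT) ?setCT ?cards0 ?muln0 //.
        by apply/setP => v; rewrite !inE eqxx.
      apply: (@card_compl_small K) => //.
      have := injF _ _ (FiP _ gF) (FiP _ hF).
      rewrite (inj_eq invg_inj) => /(_ gh).
      by rewrite /D /= (negPf gh).
    rewrite mul2n -addnn (leq_trans _ (leq_add sS sD)) // -mulnDr leq_mul2l.
    by rewrite leq_card_setU orbT.
  have : (M * #|bad| <= N ^ 2 * (2 * d))%N.
    rewrite (leq_trans (leq_mul (leqnn M) (card_bigcup_le _ _))) //.
    rewrite big_distrr /=.
    rewrite (_ : N ^ 2 = size FF)%N; last by rewrite size_allpairs mulnn.
    rewrite -sum1_size big_distrl /= !big_seq; apply: leq_sum => p pFF.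
    by rewrite mul1n small.
  rewrite /M; nia.
- by move=> g h v gF hF /(goodP _ _ _ gF hF)[]; rewrite inE => /eqP.
- move=> g h v gF hF /(goodP _ _ _ gF hF)[_].
  by rewrite inE /= => /orP[/eqP //|/eqP].
Qed.

(** Take a maximal subset [W] of [A] whose translates by [s] are disjoint.  By
    maximality every point of [A] is some [(rho g)^-1 (rho h w)] with [w] in
    [W], and there are [size s ^ 2] choices of [g] and [h]. *)
Lemma disjoint_translates d (T : eqType) (s : seq T) (rho : T -> 'S_d)
    (A : {set 'I_d}) : s != [::] ->
  exists W : {set 'I_d}, [/\ W \subset A, (#|A| <= #|W| * size s ^ 2)%N &
    forall v w g h, v \in W -> w \in W -> g \in s -> h \in s ->
      rho g v = rho h w -> v = w].
Proof.
move=> s_nil; pose sep (W : {set 'I_d}) := (W \subset A) &&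
  [forall v in W, forall w in W, (v == w) ||
    all (fun g => all (fun h => rho g v != rho h w) s) s].
have sep0 : sep set0.
  by rewrite /sep sub0set; apply/forall_inP => v; rewrite inE.
have [W /maxsetP[/andP[WA /forall_inP sepW] maxW] _] := maxset_exists sep0.
have sepWP v w g h : v \in W -> w \in W -> g \in s -> h \in s ->
    rho g v = rho h w -> v = w.
  move=> vW wW gs hs E; have /forall_inP/(_ w wW) := sepW v vW.
  by case/orP => [/eqP //|/allP/(_ g gs)/allP/(_ h hs)]; rewrite E eqxx.
exists W; split=> //.
pose ss := [seq (g, h) | g <- s, h <- s].
pose cover := \bigcup_(p <- ss) [set (rho p.1)^-1%g (rho p.2 w) | w in W].
have AW : A \subset cover.
  apply/subsetP => v vA; apply: contraT => vcov.
  have nconf w g h : w \in W -> g \in s -> h \in s -> rho g v != rho h w.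
    move=> wW gs hs; apply: contraNneq vcov => E.
    apply: (@mem_bigcup_seq _ _ _ _ (g, h)); rewrite ?allpairs_f //.
    by apply/imsetP; exists w => //=; rewrite -E permK.
  have vW : v \notin W.
    case: s s_nil nconf {sep sep0 sepW maxW sepWP ss cover vcov} => //.
    move=> g s _ nconf.
    by apply/negP => /(nconf v g g)/(_ (mem_head _ _) (mem_head _ _))/eqP.
  have : sep (v |: W).
    rewrite /sep subUset sub1set vA WA /=.
    apply/forall_inP => x xW; apply/forall_inP => y yW; apply/orP.
    have [xy|xy] := boolP (x == y); [by left|right].
    apply/allP => g gs; apply/allP => h hs.
    move: xW yW xy; rewrite !inE => /predU1P[->|xW] /predU1P[->|yW].
    - by rewrite eqxx.
    - by move=> _; apply: nconf.
    - by move=> _; rewrite eq_sym; apply: nconf.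
    - by apply: contraNneq => E; apply/eqP; apply: sepWP E.
  by move/maxW => /(_ (subsetUr _ _)) E; move: vW; rewrite -E setU11.
rewrite (leq_trans (subset_leq_card AW)) // (leq_trans (card_bigcup_le _ _)) //.
rewrite (_ : size s ^ 2 = size ss)%N; last by rewrite size_allpairs mulnn.
rewrite -sum1_size big_distrr /=; apply: leq_sum => p _.
by rewrite muln1 leq_imset_card.
Qed.

(** * Transport from the group ring to finite permutation modules *)

Section Spread.
Variables (R : pzRingType) (Gamma : groupType) (d n : nat).
Variable rho : Gamma -> 'I_d -> 'I_d.
Notation RG := (group_ring R Gamma).
Implicit Types (z : RG) (v : 'I_d) (y : 'rV[RG]_n) (x : 'M[RG]_n).

Definition mx_supp m (y : 'M[RG]_(m, n)) : seq Gamma :=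
  [seq g | p <- enum {: 'I_m * 'I_n}, g <- msupp (y p.1 p.2)].

Lemma mem_mx_supp m (y : 'M[RG]_(m, n)) i j g :
  g \in msupp (y i j) -> g \in mx_supp y.
Proof.
by move=> gy; apply/allpairsPdep; exists (i, j), g; rewrite mem_enum.
Qed.

(** The image of the group ring element [z], in column [q], under the orbit map
    [g |-> rho g v]. *)
Definition spread1 v (q : 'I_n) z : 'M[R]_(d, n) :=
  \sum_(g <- msupp z) z@_g *: delta_mx (rho g v) q.

Definition spread v y := \sum_q spread1 v q (y 0 q).

(** The [R]-linear endomorphism whose value at the basis vector at [(w, q)] is
    row [q] of [x], moved to the point [w]: right multiplication by [x], with
    [rho] in the place of the regular action of the group. *)
Definition act x (xi : 'M[R]_(d, n)) : 'M[R]_(d, n) :=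
  \sum_w \sum_q xi w q *: spread w (row q x).

Lemma spread1Ew (D : {fset Gamma}) v q z : (msupp z `<=` D)%fset ->
  spread1 v q z = \sum_(g <- D) z@_g *: delta_mx (rho g v) q.
Proof.
move=> leD; apply: big_fset_incl => // g _ /mcoeff_outdom ->.
by rewrite scale0r.
Qed.

Lemma spread1D v q : {morph spread1 v q : z1 z2 / z1 + z2}.
Proof.
move=> z1 z2; rewrite (spread1Ew _ _ (msuppD_le z1 z2)).
rewrite (spread1Ew _ _ (fsubsetUl (msupp z1) (msupp z2))).
rewrite (spread1Ew _ _ (fsubsetUr (msupp z1) (msupp z2))).
rewrite -big_split; apply: eq_bigr => g _.
by rewrite mcoeffD scalerDl.
Qed.

Lemma spread10 v q : spread1 v q 0 = 0.
Proof. by rewrite /spread1 msupp0 big_seq_fset0. Qed.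

Lemma spread1U v q (c : R) g :
  spread1 v q (<< c *g g >> : {malg R[Gamma]}) = c *: delta_mx (rho g v) q.
Proof.
by rewrite (spread1Ew _ _ msuppU_le) big_seq_fset1 mcoeffUU.
Qed.

Lemma spread0 v : spread v 0 = 0.
Proof. by rewrite /spread big1 // => q _; rewrite mxE spread10. Qed.

Lemma act_comb x (I : finType) (c : I -> R) (xi : I -> 'M[R]_(d, n)) :
  act x (\sum_i c i *: xi i) = \sum_i c i *: act x (xi i).
Proof.
rewrite /act; under [RHS]eq_bigr do rewrite scaler_sumr.
rewrite [RHS]exchange_big; apply: eq_bigr => w _ /=.
under [RHS]eq_bigr do rewrite scaler_sumr.
rewrite [RHS]exchange_big; apply: eq_bigr => q _ /=.
rewrite summxE scaler_suml; apply: eq_bigr => i _.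
by rewrite mxE scalerA.
Qed.

Lemma actZ x (c : R) xi : act x (c *: xi) = c *: act x xi.
Proof.
have := act_comb x (fun _ : 'I_1 => c) (fun=> xi).
by rewrite !big_ord1.
Qed.

Lemma act0 x : act x 0 = 0.
Proof. by have := actZ x 0 0; rewrite !scale0r. Qed.

Lemma actD x : {morph act x : xi eta / xi + eta}.
Proof.
move=> xi eta; rewrite /act -big_split; apply: eq_bigr => w _ /=.
by rewrite -big_split; apply: eq_bigr => q _; rewrite mxE scalerDl.
Qed.

Lemma act_delta x w q : act x (delta_mx w q) = spread w (row q x).
Proof.
rewrite /act (bigD1 w) //= (bigD1 q) //= mxE !eqxx scale1r.
rewrite !big1 ?addr0 // => [w' /negPf w'w|q' /negPf q'q].
  by rewrite big1 // => q' _; rewrite mxE w'w scale0r.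
by rewrite mxE q'q andbF scale0r.
Qed.

(** The product of the terms at [g] and [h] is moved to [rho h (rho g v)] on
    the left-hand side, and to [rho (g * h) v] on the right-hand side. *)
Lemma act_spread x v y :
  (forall g h, g \in mx_supp y -> h \in mx_supp x ->
     rho h (rho g v) = rho (g * h)%g v) ->
  act x (spread v y) = spread v (y *m x).
Proof.
move=> mult; rewrite /spread (big_morph _ (actD x) (act0 x)).
under [RHS]eq_bigr => q' _ do
  rewrite mxE (big_morph _ (spread1D v q') (spread10 v q')).
rewrite [RHS]exchange_big; apply: eq_bigr => q _ /=.
rewrite /spread1 (big_morph _ (actD x) (act0 x)).
under eq_bigr do rewrite actZ act_delta /spread scaler_sumr.
rewrite exchange_big; apply: eq_bigr => q' _ /=.
rewrite -/(spread1 v q' _) /GRing.mul /= /gr_mul.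
rewrite (big_morph _ (spread1D v q') (spread10 v q')) !big_seq.
apply: eq_bigr => g gy; rewrite (big_morph _ (spread1D v q') (spread10 v q')).
rewrite mxE /spread1 scaler_sumr !big_seq; apply: eq_bigr => h hx.
rewrite -/(spread1 v q' _) spread1U scalerA mult //.
  exact: mem_mx_supp gy.
exact: mem_mx_supp hx.
Qed.

Lemma spreadE v y u q :
  spread v y u q = \sum_(g <- msupp (y 0 q) | rho g v == u) (y 0 q)@_g.
Proof.
rewrite /spread summxE (bigD1 q) //= big1 ?addr0 => [|q' /negPf q'q].
  rewrite summxE [RHS]big_mkcond; apply: eq_bigr => g _.
  rewrite !mxE eqxx andbT eq_sym.
  by case: ifP; rewrite ?mulr1 ?mulr0.
rewrite summxE big1 // => g _; by rewrite !mxE (eq_sym q) q'q andbF mulr0.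
Qed.

Lemma spread_neq0 v y : y != 0 ->
  (forall g h, g \in mx_supp y -> h \in mx_supp y ->
     rho g v = rho h v -> g = h) ->
  spread v y != 0.
Proof.
move=> ynz inj; have [q yq] : exists q, y 0 q != 0.
  apply/existsP; apply: contraNT ynz; rewrite negb_exists => /forallP y0.
  by apply/eqP/rowP => q; rewrite mxE; apply/eqP/negPn/y0.
have [g gy] : exists g, g \in msupp (y 0 q).
  apply/fset0Pn; apply: contra_neq yq => y0.
  by rewrite [LHS](@monalgE Gamma R) y0 big_seq_fset0.
apply: contraTneq gy => /matrixP/(_ (rho g v) q); rewrite spreadE mxE.
case: (boolP (g \in _)) => // gy.
rewrite big_mkcond (bigD1_seq g) ?fset_uniq //= eqxx big_seq_cond big1 ?addr0.
  by move/eqP; rewrite mcoeff_eq0 gy.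
move=> h /andP[hy /eqP hg]; case: eqP => // E; case: hg; apply: inj E.
  exact: mem_mx_supp hy.
exact: mem_mx_supp gy.
Qed.

(** The translates of the points of [W] by the support of [y] being disjoint, no
    entry is nonzero in two of the matrices [spread v y]. *)
Lemma spread_disjoint (W : {set 'I_d}) y (c : {v | v \in W} -> R) :
  (forall v w g h, v \in W -> w \in W -> g \in mx_supp y -> h \in mx_supp y ->
      rho g v = rho h w -> v = w) ->
  \sum_i c i *: spread (sval i) y = 0 -> forall i, c i *: spread (sval i) y = 0.
Proof.
move=> sep s0 v; apply/matrixP => u q; rewrite !mxE.
have [vu|vu] := eqVneq (spread (sval v) y u q) 0; first by rewrite vu mulr0.
move/matrixP/(_ u q): s0; rewrite summxE (bigD1 v) //= !mxE.
rewrite big1 ?addr0 // => w wv; rewrite mxE.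
have [->|wu] := eqVneq (spread (sval w) y u q) 0; first by rewrite mulr0.
have hit (i : {v | v \in W}) : spread (sval i) y u q != 0 ->
    exists2 g, g \in mx_supp y & rho g (sval i) = u.
  rewrite spreadE => nz; apply: contrapT => nh; case/eqP: nz.
  rewrite big_seq_cond big1 // => g /andP[gy /eqP gi]; case: nh; exists g => //.
  exact: mem_mx_supp gy.
have [g gy gv] := hit v vu; have [h hy hw] := hit w wu.
case/eqP: wv; apply/val_inj/(sep (sval w) (sval v) h g) => //.
- exact: (svalP w).
- exact: (svalP v).
by rewrite hw.
Qed.

End Spread.

(** * One-sided inverses *)

Section MatrixUnits.
Variables (S : pzRingType) (a b : S).
Hypothesis ab1 : a * b = 1.
Let e := 1 - b * a.

Lemma matrix_units i j : e * a ^+ i * (b ^+ j * e) = if i == j then e else 0.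
Proof.
have ae : a * e = 0 by rewrite mulrBr mulr1 mulrA ab1 mul1r subrr.
have eb : e * b = 0 by rewrite mulrBl mul1r -mulrA ab1 mulr1 subrr.
elim: i j => [|i IHi] [|j].
- by rewrite mulr1 mul1r eqxx {1}/e mulrBl mul1r -mulrA ae mulr0 subr0.
- by rewrite mulr1 exprS !mulrA eb !mul0r.
- by rewrite exprSr mul1r -!mulrA ae !mulr0.
- by rewrite exprSr exprS -!mulrA (mulrA a) ab1 mul1r eqSS -IHi !mulrA.
Qed.

End MatrixUnits.

Theorem theorem1p2 (K : realType) (R : pzRingType) (Gamma : groupType) :
  left_noetherian R -> sofic K Gamma ->
  stably_directly_finite (group_ring R Gamma).
Proof.
move=> noeth sof n a b ab1; apply: contrapT => ba1.
pose e := 1 - b * a.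
have [p ep] : exists p, row p e != 0.
  apply: contrapT => e0; apply: ba1; apply/eqP; rewrite eq_sym -subr_eq0.
  apply/eqP/row_matrixP => p; rewrite row0; apply/eqP/negPn/negP => ep.
  by apply: e0; exists p.
set y := row p e in ep.
have [r rP] := independent_matrices_bounded noeth.
pose s := mx_supp y; pose k := (2 * size s ^ 2 * (n * r)).+1.
pose F := flatten [seq mx_supp (y *m a ^+ i) ++ mx_supp (a ^+ i) ++
                       mx_supp (b ^+ i * e) | i <- iota 0 k] ++ s.
have sF g : g \in s -> g \in F by rewrite mem_cat => ->; rewrite orbT.
have FP i g : (i < k)%N ->
    [|| g \in mx_supp (y *m a ^+ i), g \in mx_supp (a ^+ i)
      | g \in mx_supp (b ^+ i * e)] -> g \in F.
  move=> ik gi; rewrite mem_cat; apply/orP; left; apply/flatten_mapP; exists i.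
    by rewrite mem_iota.
  by rewrite !mem_cat.
have [d [rho [A [d0 dA mult inj]]]] := sofic_good_points F sof.
have s_nil : s != [::].
  apply: contraNneq ep => s0; apply/eqP/rowP => q; rewrite [RHS]mxE.
  rewrite [LHS](@monalgE Gamma R) big_seq big1 // => g.
  by move=> /mem_mx_supp; rewrite -/s s0.
have [W [/subsetP WA AW sep]] := disjoint_translates rho A s_nil.
pose w (vi : {v | v \in W} * 'I_k) : 'M[R]_(d, n) :=
  spread rho (sval vi.1) (y *m a ^+ vi.2).
have actB v i j : v \in W -> (i < k)%N -> (j < k)%N ->
    act rho (b ^+ j * e) (spread rho v (y *m a ^+ i)) =
    if i == j then spread rho v y else 0.
  move=> vW ik jk; rewrite act_spread => [|g h gy hx]; last first.
    have gF : g \in F by apply: (FP i); rewrite ?gy.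
    have hF : h \in F by apply: (FP j); rewrite ?hx ?orbT.
    by rewrite mult ?WA.
  rewrite /y -!row_mul.
  rewrite [e *m _ *m _](matrix_units ab1 i j) -/e; case: eqP => // _.
  by rewrite row0 spread0.
have actA v i : v \in W -> (i < k)%N ->
    act rho (a ^+ i) (spread rho v y) = spread rho v (y *m a ^+ i).
  move=> vW ik; apply: act_spread => g h gy hx.
  have hF : h \in F by apply: (FP i); rewrite ?hx ?orbT.
  have gF := sF g gy.
  by rewrite mult ?WA.
have ynz v : v \in W -> spread rho v y != 0.
  move=> vW; apply: spread_neq0 => // g h gs hs; apply: inj; rewrite ?sF //.
  exact: WA.
have wnz vi : w vi != 0.
  case: vi => -[v vW] i; apply: contra_neq (ynz v vW) => w0.
  have := actB v i i vW (ltn_ord i) (ltn_ord i).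
  by rewrite eqxx -[X in act _ _ X]/(w (exist _ v vW, i)) w0 act0.
have indw : independent w.
  move=> c sum0 [v j].
  (* [act (b ^+ j * e)] isolates the vectors of index [j] and takes them back to
     [spread v y]; once these terms vanish, [act (a ^+ j)] shows that the
     original terms vanish too. *)
  suff c0 : c (v, j) *: spread rho (sval v) y = 0.
    by rewrite /w /= -actA ?(svalP v) // -actZ c0 act0.
  apply: (spread_disjoint (c := fun v => c (v, j)) (y := y)) v => //.
  have := congr1 (act rho (b ^+ j * e)) sum0; rewrite act0 act_comb => E.
  apply: etrans E.
  pose T v i := c (v, i) *: act rho (b ^+ j * e) (w (v, i)).
  rewrite (eq_bigr (fun vi => T vi.1 vi.2)); last by case.
  rewrite -pair_bigA /=.
  apply: eq_bigr => v _; rewrite /T (bigD1 j) //= big1 ?addr0 => [|i ij].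
    by rewrite actB ?(svalP v) ?eqxx.
  by rewrite actB ?(svalP v) // (inj_eq val_inj) (negPf ij) scaler0.
have := rP _ _ _ _ indw wnz.
rewrite card_prod card_sig card_ord /k -/s in AW *.
have -> : #|[pred x in W]| = #|W| by apply: eq_card.
move: AW dA d0; set N := (size s ^ 2)%N; rewrite -/N; nia.
Qed.
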